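(* Let $\mathbf{f}$ be the Fibonacci word and let $\mathbf{cubes_f}$ be the infinite binary word whose $n$-th term ($n\ge 0$) is $1$ if a cube ends at position $n$ of $\mathbf{f}$ and $0$ otherwise. The (maximal) runs of $0$'s in $\mathbf{cubes_f}$ have lengths in $\{1,2,3,7,8,13\}$. The only run of length $13$ occurs at the beginning of $\mathbf{cubes_f}$ (i.e., starts at position $0$). For each of the lengths $1,2,3,7,8$ there are infinitely many runs of $0$'s of that length in $\mathbf{cubes_f}$.
   Context: The Fibonacci word is $\mathbf{f}=010010100100101001010010\cdots$, the fixed point of the morphism $0\mapsto 01$, $1\mapsto 0$; its letters are indexed starting from position $0$, and $\mathbf{f}[a..b]$ denotes the factor occupying positions $a$ through $b$. A cube is a word of the form $xxx$ with $x$ nonempty. A cube ends at position $j$ of $\mathbf{f}$ if there exist $i\ge 0$ and $m\ge 1$ with $j=i+3m-1$ such that $\mathbf{f}[i..j]=xxx$ for some word $x$ of length $m$. A run of $0$'s of length $\ell\ge1$ beginning at position $i$ in a binary word $\mathbf{u}=u_0u_1\cdots$ means $u_i=\cdots=u_{i+\ell-1}=0$, $u_{i+\ell}=1$, and either $i=0$ or $u_{i-1}=1$. *)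

(* Defs.v *)
From mathcomp Require Import all_boot.

Set Implicit Arguments.
Unset Strict Implicit.
Unset Printing Implicit Defensive.

(** Letters are booleans: [false] is the letter 0 and [true] is the letter 1. *)
Definition word := seq bool.
Definition inf_word := nat -> bool.

(** A morphism is given by its images of letters. *)
Definition morph_word (h : bool -> word) (w : word) : word :=
  flatten [seq h a | a <- w].

(** For a nonerasing [h], position [n] of the image of [u] lies within the image
    of the prefix of [u] of length [n.+1], so the default letter is not used. *)
Definition morph_inf (h : bool -> word) (u : inf_word) : inf_word :=
  fun n => nth false (morph_word h (mkseq u n.+1)) n.

Definition fib_morph (a : bool) : word :=
  if a then [:: false] else [:: false; true].

(** The iterates of [fib_morph] on the word 0 are prefixes of one another, and
    the [n]-th one has length greater than [n]. [fib_word_fixed] and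
    [fib_word_unique] show that their limit is the only fixed point. *)
Definition fib_prefix (n : nat) : word :=
  iter n (morph_word fib_morph) [:: false].

Definition fib_word : inf_word := fun n => nth false (fib_prefix n) n.

(** [u[a..b]], both ends included. *)
Definition factor (u : inf_word) (a b : nat) : word :=
  [seq u k | k <- iota a (b.+1 - a)].

Definition cube_ends_at (u : inf_word) (j : nat) : Prop :=
  exists i m, [/\ 1 <= m, j = i + 3 * m - 1 &
    exists2 x : word, size x = m & factor u i j = x ++ x ++ x].

(** Boolean version of [cube_ends_at] (see [cubesP]): the bounds on [i] and [m]
    are implied by [j = i + 3 * m - 1] and [1 <= m], and the only candidate for
    the root of the cube is the prefix of length [m] of the factor. *)
Definition cubes (u : inf_word) : inf_word := fun j =>
  [exists i : 'I_j.+1, exists m : 'I_j.+2,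
    [&& 1 <= m, j == i + 3 * m - 1 &
        let x := take m (factor u i j) in factor u i j == x ++ x ++ x]].

(** A maximal block of [l] letters 0 beginning at position [i]; it is finite by
    definition, being followed by a letter 1. *)
Definition zero_run (u : inf_word) (i l : nat) : Prop :=
  [/\ 1 <= l, forall k, k < l -> u (i + k) = false, u (i + l) = true &
      i = 0 \/ u (i - 1) = true].

Lemma cubesP (u : inf_word) (j : nat) : reflect (cube_ends_at u j) (cubes u j).
Proof.
have szf i m : 0 < m -> j = i + 3 * m - 1 -> size (factor u i j) = 3 * m.
  move=> m0 ->; rewrite size_map size_iota.
  have h : 0 < i + 3 * m by rewrite addn_gt0 muln_gt0 m0 orbT.
  by rewrite subn1 prednK // addKn.
apply: (iffP existsP) => [[i /existsP[m /and3P[m0 /eqP ej /eqP ex]]]|].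
  exists i, m; split=> //; exists (take m (factor u i j)) => //.
  by rewrite size_takel // (szf i m) // leq_pmull.
move=> [i [m [m0 ej [x sx ex]]]].
have e3 : j.+1 = i + 3 * m.
  by rewrite ej subn1 prednK // addn_gt0 muln_gt0 m0 orbT.
have m3 : m <= 3 * m by rewrite leq_pmull.
have im : m < j.+2 by rewrite ltnS e3 (leq_trans m3) // leq_addl.
have ii : i < j.+1 by rewrite e3 -[X in X < _]addn0 ltn_add2l muln_gt0 m0.
exists (Ordinal ii); apply/existsP; exists (Ordinal im) => /=.
rewrite m0 -ej eqxx /=; apply/eqP.
by rewrite ex -sx take_size_cat.
Qed.

Lemma morph_word_cat h s t :
  morph_word h (s ++ t) = morph_word h s ++ morph_word h t.
Proof. by rewrite /morph_word map_cat flatten_cat. Qed.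

Lemma size_morph_word_fib w : size w <= size (morph_word fib_morph w).
Proof.
elim: w => //= a w IH; rewrite /morph_word /= size_cat -/(morph_word _ w).
by case: a => //=; rewrite ltnS // ltnW.
Qed.

Lemma nth_morph_fib (u : inf_word) m n :
  n < size (morph_word fib_morph (mkseq u m)) ->
  nth false (morph_word fib_morph (mkseq u m)) n = morph_inf fib_morph u n.
Proof.
have mk p q : p <= q -> exists t, mkseq u q = mkseq u p ++ t.
  move=> pq; exists (map u (iota p (q - p))).
  by rewrite /mkseq -map_cat -iotaD subnKC.
have ltS : n < size (morph_word fib_morph (mkseq u n.+1)).
  by apply: leq_trans (size_morph_word_fib _); rewrite size_mkseq.
rewrite /morph_inf => ltm; have [/mk[t e]|/ltnW/mk[t e]] := leqP m n.+1.
  by rewrite e morph_word_cat nth_cat ltm.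
by rewrite e morph_word_cat nth_cat ltS.
Qed.

Lemma fib_prefixS n : exists a t, fib_prefix n.+1 = fib_prefix n ++ a :: t.
Proof.
elim: n => [|n [a [t IH]]]; first by exists true, [::].
have e : fib_prefix n.+2 = morph_word fib_morph (fib_prefix n.+1) by [].
rewrite e {1}IH morph_word_cat.
exists false; case: a {IH} => /=; first by exists (morph_word fib_morph t).
by exists (true :: morph_word fib_morph t).
Qed.

Lemma size_fib_prefix n : n < size (fib_prefix n).
Proof.
elim: n => // n IH; have [a [t ->]] := fib_prefixS n.
by rewrite size_cat /= addnS ltnS (leq_trans IH) // leq_addr.
Qed.

Lemma fib_prefix_leq m n : m <= n -> exists t, fib_prefix n = fib_prefix m ++ t.
Proof.
move=> /subnKC <-; elim: (n - m) => [|k [t IH]].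
  by exists [::]; rewrite addn0 cats0.
have [a [s e]] := fib_prefixS (m + k).
by exists (t ++ a :: s); rewrite addnS e IH catA.
Qed.

Lemma nth_fib_prefix m n :
  n < size (fib_prefix m) -> nth false (fib_prefix m) n = fib_word n.
Proof.
move=> ltm; rewrite /fib_word.
have [/fib_prefix_leq[t e]|/ltnW/fib_prefix_leq[t e]] := leqP m n.
  by rewrite e nth_cat ltm.
by rewrite e nth_cat size_fib_prefix.
Qed.

Lemma fib_prefixE m : mkseq fib_word (size (fib_prefix m)) = fib_prefix m.
Proof.
apply: (@eq_from_nth _ false); rewrite size_mkseq // => i lti.
by rewrite nth_mkseq // nth_fib_prefix.
Qed.

Lemma fib_word_fixed : morph_inf fib_morph fib_word =1 fib_word.
Proof.
move=> n; rewrite -(@nth_morph_fib _ (size (fib_prefix n))) fib_prefixE.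
  by rewrite -[morph_word _ _]/(fib_prefix n.+1) nth_fib_prefix // ltnW // size_fib_prefix.
by rewrite -[morph_word _ _]/(fib_prefix n.+1) ltnW // size_fib_prefix.
Qed.

Lemma fib_word_unique (u : inf_word) :
  morph_inf fib_morph u =1 u -> u =1 fib_word.
Proof.
move=> fixu; suff e m : mkseq u (size (fib_prefix m)) = fib_prefix m.
  by move=> n; rewrite /fib_word -[in RHS]e nth_mkseq // size_fib_prefix.
elim: m => [|m IH].
  have u0 : u 0 = false.
    by rewrite -fixu /morph_inf -[mkseq u 1]/[:: u 0]; case: (u 0).
  by rewrite /= -[mkseq u 1]/[:: u 0] u0.
apply: (@eq_from_nth _ false); rewrite size_mkseq // => i lti.
rewrite nth_mkseq // -[fib_prefix m.+1]/(morph_word fib_morph (fib_prefix m)).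
by rewrite -[in RHS]IH nth_morph_fib ?fixu // IH.
Qed.

(* Main.v *)
Require Import Defs.
From mathcomp Require Import all_boot.
From mathcomp Require Import zify.

Set Implicit Arguments.
Unset Strict Implicit.
Unset Printing Implicit Defensive.

(** Write [phi n] for the length of the image of the first [n] letters of the
    Fibonacci word [f] under the morphism. An occurrence of [p]-periodicity of
    length at least [3p - 1] in [f] is desubstituted by the morphism to another
    one with a smaller period, until a square 00, the image of a letter 1 and
    the letter after it, is reached. Hence all cubes lie in explicit runs: the
    letter 1 at position [s] gives at level [k] the run [phi^k(s), e_k) of
    period [phi^k(s+1) - phi^k(s)], where [e_0 = s+1] and
    [e_(k+1) = phi(e_k) + 1], and this run contains cubes exactly when [k >= 3].
    A cube ends just before position [n] iff [n] lies in one of the intervals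
    from the end of the third period of such a run to [e_k]. Applying [phi] to these
    intervals shows that finitely many bits at [n] determine the same bits at the
    positions of the image of the letter at [n]; so the cube word is a coding of
    a fixed point of a morphism on a finite alphabet, and both the possible runs
    of zeros and their recurrence are read off from finitely many factors. *)

Local Notation f := fib_word.

(** * Positions of image blocks in the Fibonacci word *)

Definition phi (n : nat) : nat := size (morph_word fib_morph (mkseq f n)).

Arguments phi : simpl never.

Lemma phi0 : phi 0 = 0. Proof. by []. Qed.

Lemma morph_mkseqS n :
  morph_word fib_morph (mkseq f n.+1)
  = morph_word fib_morph (mkseq f n) ++ fib_morph (f n).
Proof. by rewrite mkseqS -cats1 morph_word_cat /morph_word /= cats0. Qed.

Lemma phiS n : phi n.+1 = phi n + (if f n then 1 else 2).
Proof. by rewrite /phi morph_mkseqS size_cat; case: (f n). Qed.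

Lemma fib_phi n : f (phi n) = false.
Proof.
rewrite -fib_word_fixed -(@nth_morph_fib f n.+1); last first.
  by rewrite -/(phi n.+1) phiS; case: (f n); lia.
by rewrite morph_mkseqS nth_cat -/(phi n) ltnn subnn; case: (f n).
Qed.

Lemma fib_phiS n : f n = false -> f (phi n).+1 = true.
Proof.
move=> fn; rewrite -fib_word_fixed -(@nth_morph_fib f n.+1); last first.
  by rewrite -/(phi n.+1) phiS fn; lia.
rewrite morph_mkseqS nth_cat -/(phi n) ifF; last by lia.
by rewrite subSnn fn.
Qed.

Lemma phiSt n : f n = true -> phi n.+1 = (phi n).+1.
Proof. by move=> fn; rewrite phiS fn addn1. Qed.

Lemma phiSf n : f n = false -> phi n.+1 = (phi n).+2.
Proof. by move=> fn; rewrite phiS fn addn2. Qed.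

Lemma leq_phi : {mono phi : m n / m <= n}.
Proof.
apply: leq_mono; apply: homo_ltn => [|i]; first exact: ltn_trans.
by rewrite phiS; case: (f i); lia.
Qed.

Lemma ltn_phi : {mono phi : m n / m < n}.
Proof. by move=> m n; rewrite !ltnNge leq_phi. Qed.

Lemma phi_inj : injective phi.
Proof. by move=> m n /eqP; rewrite eqn_leq !leq_phi -eqn_leq => /eqP. Qed.

Lemma phi_ge n : n <= phi n.
Proof. by elim: n => // n IH; rewrite phiS; case: (f n); lia. Qed.

Lemma phi_ge_sub n i : phi n + i <= phi (n + i).
Proof.
by elim: i => [|i IH]; rewrite ?addn0 // !addnS phiS; case: (f _); lia.
Qed.

Variant phi_spec : nat -> Prop :=
  | PhiBlock0 n : phi_spec (phi n)
  | PhiBlock1 n of f n = false : phi_spec (phi n).+1.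

Lemma phiP N : phi_spec N.
Proof.
elim: N => [|N [n|n fn]]; first by rewrite -phi0; constructor.
  case fn : (f n); last by constructor.
  by rewrite -phiSt //; constructor.
by rewrite -phiSf //; constructor.
Qed.

Lemma phi_neqS m n : f n = false -> phi m <> (phi n).+1.
Proof. by move=> fn e; have := fib_phi m; rewrite e fib_phiS. Qed.

Lemma phi_of_false N : f N = false -> exists n, N = phi n.
Proof. by case: (phiP N) => [n _|n fn]; [exists n|rewrite fib_phiS]. Qed.

Lemma phi_of_true N : f N = true -> exists2 n, f n = false & N = (phi n).+1.
Proof. by case: (phiP N) => [n|n fn _]; [rewrite fib_phi|exists n]. Qed.

Lemma fib_no11 n : f n = true -> f n.+1 = false.
Proof. by case/phi_of_true=> m fm ->; rewrite -phiSf ?fib_phi. Qed.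

Lemma phi_SS n : phi n + 3 <= phi n.+2.
Proof.
rewrite !phiS; case fn: (f n); last by case: (f n.+1); lia.
by rewrite fib_no11 //; lia.
Qed.

Lemma fib_001 n : f n = false -> f n.+1 = false -> f n.+2 = true.
Proof.
case/phi_of_false=> m ->; case fm: (f m); last by rewrite fib_phiS.
rewrite -phiSt // => _; rewrite fib_phiS //; exact: fib_no11.
Qed.

(** * Transport of periodicity through the morphism *)

(** For [a <= b] this is periodicity with period [b - a] on [[a, e)]: the bound [e] applies to the
    shifted copy. *)
Definition agree (a b e : nat) : Prop :=
  forall i, b + i < e -> f (a + i) = f (b + i).

Lemma agree_phi_sub a b e i : agree a b e -> b + i <= e ->
  phi (b + i) + phi a = phi (a + i) + phi b.
Proof.
move=> ab; elim: i => [|i IH] le; first by rewrite !addn0 addnC.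
rewrite !addnS !phiS ab; last by lia.
have := IH ltac:(lia); case: (f _); lia.
Qed.

(** The additional letter at [phi e] comes for free, because both images of letters begin with 0. *)
Lemma agree_phi a b e : agree a b e -> agree (phi a) (phi b) (phi e).+1.
Proof.
move=> ab j; move eN: (phi b + j) => N.
case: (phiP N) eN => [n|n fn] eN ltN.
  have bn : b <= n by rewrite -leq_phi; lia.
  have ne : n <= e by rewrite -leq_phi.
  have := agree_phi_sub ab (i := n - b); rewrite subnKC // => /(_ ne) eq.
  have -> : phi a + j = phi (a + (n - b)) by lia.
  by rewrite !fib_phi.
have bn : b <= n.
  have: phi b < phi n.+1; last by rewrite ltn_phi.
  by rewrite (phiSf fn); lia.
have ne : n < e by rewrite -ltn_phi.
have := agree_phi_sub ab (i := n - b); rewrite subnKC // => /(_ (ltnW ne)) eq.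
have -> : phi a + j = (phi (a + (n - b))).+1 by lia.
by rewrite !fib_phiS // ab subnKC.
Qed.

Lemma fib_phi_succ n : f (phi n).+1 = ~~ f n.
Proof.
by case fn: (f n); [rewrite -phiSt ?fib_phi|rewrite fib_phiS].
Qed.

(** By [fib_phi_succ] the letter at [k] is read off at [(phi k).+1]. Decoding goes from left to
    right: agreement so far keeps the blocks of both copies aligned. *)
Lemma agree_unphi a b e E : agree (phi a) (phi b) e ->
  (forall k, k < E -> (phi k).+1 < e) -> agree a b E.
Proof.
move=> ab ltE; elim: E => [|E IH] in ltE *; first by move=> i; lia.
have {}IH : agree a b E by apply: IH => k ltk; apply: ltE; lia.
move=> i; rewrite ltnS leq_eqVlt => /predU1P[eE|]; last exact: IH.
have eq : phi (b + i) + phi a = phi (a + i) + phi b.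
  by apply: (agree_phi_sub IH); rewrite eE.
have le : phi a <= phi (a + i) by rewrite leq_phi leq_addr.
apply: negb_inj; rewrite -!fib_phi_succ.
have := ab ((phi (a + i)).+1 - phi a); rewrite subnKC; last by lia.
have -> : phi b + ((phi (a + i)).+1 - phi a) = (phi (b + i)).+1 by lia.
by apply; apply: ltE; lia.
Qed.

(** Supplies the end for [agree_unphi]. The bound [(phi E).+1] matches the recursion of [run_end],
    so no letter is lost on the way back up. *)
Lemma phi_ceil e : exists2 E, e <= (phi E).+1 & forall k, k < E -> (phi k).+1 < e.
Proof.
case: e => [|N]; first by exists 0.
case: (phiP N) => [n|n fn]; first by exists n => // k; rewrite -ltn_phi.
exists n.+1 => [|k]; first by rewrite phiSf.
by rewrite ltnS -leq_phi; lia.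
Qed.

(** * The explicit runs *)

Definition run_end (k s : nat) : nat := iter k (fun e => (phi e).+1) s.+1.
Definition run_start (k s : nat) : nat := iter k phi s.
Arguments run_end : simpl never.
Arguments run_start : simpl never.

Lemma run_endS k s : run_end k.+1 s = (phi (run_end k s)).+1. Proof. by []. Qed.
Lemma run_startS k s : run_start k.+1 s = phi (run_start k s). Proof. by []. Qed.

Lemma fib_run_end k s : f s = true -> f (run_end k s) = odd k.
Proof.
move=> fs; elim: k => [|k IH]; first exact: fib_no11.
rewrite run_endS /=; case: (odd k) IH => IH; last exact: fib_phiS.
by rewrite -phiSt ?fib_phi.
Qed.

Lemma run_agree k s : agree (run_start k s) (run_start k s.+1) (run_end k s).
Proof.
elim: k => [|k IH]; first by move=> i; rewrite /run_start /run_end /=; lia.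
exact: agree_phi.
Qed.

Lemma run_start_lt k s : run_start k s < run_start k s.+1.
Proof. by elim: k => // k; rewrite !run_startS ltn_phi. Qed.

(* Where the third period of the run ends, if [3 <= k] ([third_period]). *)
Definition third (k s : nat) : nat := iter (k - 3) phi (run_end 3 s).

Lemma thirdS k s : 3 <= k -> third k.+1 s = phi (third k s).
Proof. by move=> k3; rewrite /third subSn. Qed.

Lemma third_le k s : f s = true -> 3 <= k -> third k s <= run_end k s.
Proof.
move=> fs; elim: k => // k IH; rewrite leq_eqVlt => /predU1P[<-//|k3].
by rewrite thirdS // run_endS ltnW // ltnS leq_phi IH.
Qed.

(** Levels 1, 2, 3 have periods 1, 2, 3 and lengths 2, 5, 9: the first two are one letter short of a
    cube, and the third is exactly a cube. *)
Lemma run_start_third3 s : f s = true ->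
  [/\ run_start 1 s.+1 = run_start 1 s + 1, run_end 1 s = run_start 1 s + 2,
      run_start 2 s.+1 = run_start 2 s + 2, run_end 2 s = run_start 2 s + 5 &
      run_start 3 s.+1 = run_start 3 s + 3 /\ run_end 3 s = run_start 3 s + 9].
Proof.
move=> fs; have fs1 := fib_no11 fs.
have f1 : f (phi s).+1 = false by rewrite -phiSt ?fib_phi.
have f2 : f (phi s).+2 = true by apply: fib_001 => //; exact: fib_phi.
have f0 := fib_phi s.
have e1 : phi (phi s).+1 = (phi (phi s)).+2 by rewrite phiSf.
have e2 : phi (phi s).+2 = (phi (phi s)).+4 by rewrite phiSf // e1.
have e3 : phi (phi s).+3 = (phi (phi s)).+4.+1 by rewrite phiSt // e2.
rewrite /run_start /run_end /= !(phiSt fs) e1 e2.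
set t := phi (phi s) in e1 e2 e3 *.
have g0 : f t = false by exact: fib_phi.
have g1 : f t.+1 = true by exact: fib_phiS.
have g2 : f t.+2 = false by exact: fib_no11.
have g3 : f t.+3 = true by rewrite -e1 fib_phiS.
have g4 : f t.+4 = false by exact: fib_no11.
have h1 : phi t.+2 = phi t + 3 by rewrite phiSt // phiSf // addn3.
have h2 : phi t.+4 = phi t + 6 by rewrite phiSt // phiSf // h1 -!addnS.
have h3 : phi t.+4.+1 = phi t + 8 by rewrite phiSf // h2 -!addnS.
by rewrite h1 h3 !addnS !addn0.
Qed.

(** The three consecutive periods are equal factors, so [phi] lengthens them equally
    ([agree_phi_sub] at one and two periods). *)
Lemma third_period k s : f s = true -> 3 <= k ->
  third k s + 2 * run_start k s = 3 * run_start k s.+1.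
Proof.
move=> fs; elim: k => // k IH; rewrite leq_eqVlt => /predU1P[<-|k3].
  have [_ _ _ _ [-> e]] := run_start_third3 fs.
  by have -> : third 3 s = run_end 3 s; [|rewrite e; lia].
have {}IH := IH k3; have le := third_le fs k3; have ab := @run_agree k s.
rewrite thirdS // !run_startS.
have ltab := run_start_lt k s.
set a := run_start k s in IH ab ltab *; set b := run_start k s.+1 in IH ab ltab *.
have := agree_phi_sub ab (i := b - a); have := agree_phi_sub ab (i := 2 * (b - a)).
have -> : b + 2 * (b - a) = third k s by lia.
have -> : a + 2 * (b - a) = b + (b - a) by lia.
have -> : a + (b - a) = b by lia.
by move=> /(_ le) ? /(_ ltac:(lia)); lia.
Qed.

(** * Every cube lies in an explicit run *)

Lemma run_complete m a e : 1 <= m -> agree a (a + m) e -> a + 3 * m <= e.+1 ->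
  exists k s, [/\ f s = true, 1 <= k, run_start k s <= a, e <= run_end k s &
    run_start k s.+1 = run_start k s + m].
Proof.
elim/ltn_ind: m a e => m IH a e m0 am le.
(* Period 1: the factor contains 00 and 000 does not occur, so it is the level 1 run of a letter 1
   at [s]. *)
have [m1|m1] := leqP m 1.
  have {m0 m1}em : m = 1 by lia.
  subst m; have f0 := am 0; have f1 := am 1; rewrite !addn0 in f0.
  have {}f0 : f a = f a.+1 by rewrite f0 ?addn1 //; lia.
  have fa : f a = false by case fa: (f a) f0 => // /esym; rewrite fib_no11.
  have fa1 : f a.+1 = false by rewrite -f0.
  have fa2 := fib_001 fa fa1.
  have lea : e <= a.+2.
    by rewrite leqNgt; apply/negP=> lt; move: f1; rewrite !addn1 fa1 fa2 => /(_ lt).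
  have [s es] := phi_of_false fa; subst a.
  have fs : f s = true by move: fa1; rewrite fib_phi_succ => /negbFE.
  by exists 1, s; rewrite /run_start /run_end /= !phiSt // addn1.
(* Move the start to a block boundary. If the factor starts with 1, so does its shifted copy, and
   both are preceded by 0, so the period extends one letter to the left. *)
have [a' [a'a aa' fa' am']] : exists a',
    [/\ a' <= a, a <= a'.+1, f a' = false & agree a' (a' + m) e].
  case fa: (f a); last by exists a.
  have [n fn ea] := phi_of_true fa; exists (phi n); rewrite fib_phi.
  split=> //; try lia.
  case=> [|i] lti; last by rewrite !addnS -!addSn -ea am //; lia.
  rewrite !addn0 fib_phi; case fam: (f (phi n + m)) => //.
  have := fib_no11 fam; have := am 0; rewrite !addn0 ea.
  by move=> <-; [rewrite -ea fa|lia].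
have [x ex] := phi_of_false fa'; subst a'.
have fm : f (phi x + m) = false.
  by have := am' 0; rewrite !addn0 fib_phi => <- //; lia.
have [y ey] := phi_of_false fm.
have f2m : f (phi x + 2 * m) = false.
  have -> : phi x + 2 * m = phi x + m + m by lia.
  by rewrite -am' //; lia.
have [E leE ltE] := phi_ceil e.
rewrite ey in am'; have xyE := agree_unphi am' ltE.
have xy : x < y by rewrite -ltn_phi; lia.
set q := y - x; have eyq : y = x + q by rewrite /q; lia.
have q0 : 0 < q by rewrite /q; lia.
have shift i : y + i <= E -> phi (y + i) = phi (x + i) + m.
  by move=> le'; have := agree_phi_sub xyE le'; lia.
have yE : y <= E.
  by rewrite leqNgt -ltn_phi; apply/negP; lia.
(* Otherwise [phi E < phi x + 2 * m], while [phi E >= phi x + 3 * m - 2] and [m >= 2]. *)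
have E2 : y + q <= E.
  rewrite leqNgt; apply/negP=> ltq.
  have := shift (E - y); rewrite subnKC // => /(_ (leqnn _)).
  have : phi (x + (E - y)) < phi y by rewrite ltn_phi; lia.
  by lia.
(* If two or more letters were missing, their image would have at least three letters ([phi_SS]),
   but [phi E] is at most two short of [phi x + 3 * m]. *)
have E3 : x + 3 * q <= E.+1.
  rewrite leqNgt; apply/negP=> ltq.
  have := shift (E - y); rewrite subnKC // => /(_ (leqnn _)).
  have := shift (E - y - q).
  have -> : y + (E - y - q) = x + (E - y) by lia.
  move=> /(_ ltac:(lia)); have := phi_SS (x + (E - y - q)).
  have : phi (x + (E - y - q)).+2 <= phi y by rewrite leq_phi; lia.
  by lia.
have qm : q < m.
  have [q1|q1] := leqP q 1; first by lia.
  have := phi_SS x; have := phi_ge_sub x.+2 (q - 2).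
  have -> : x.+2 + (q - 2) = y by lia.
  by lia.
have [k [s [fs k1 lex leE' es]]] := IH q qm x E q0 ltac:(by rewrite -eyq) E3.
exists k.+1, s; rewrite !run_startS run_endS es; split=> //.
- by rewrite (leq_trans _ a'a) // leq_phi.
- by rewrite (leq_trans leE) // ltnS leq_phi.
(* The period of the image run, measured at [x], is [phi y - phi x = m]. *)
have ab := @run_agree k s; rewrite es in ab.
have := agree_phi_sub ab (i := x - run_start k s).
have -> : run_start k s + q + (x - run_start k s) = y by lia.
rewrite subnKC // => /(_ (leq_trans yE leE')); lia.
Qed.

Lemma cube_covered n : 0 < n -> 
  cubes f n.-1 <-> exists k s, [/\ 3 <= k, f s = true & third k s <= n <= run_end k s].
Proof.
move=> n0; split=> [/cubesP[i [m [m0 en [x sx ex]]]]|[k [s [k3 fs le]]]].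
  have {}en : n = i + 3 * m by lia.
  have ax : agree i (i + m) n.
    move=> j ltj; have nthf d : d < 3 * m -> f (i + d) = nth false (x ++ x ++ x) d.
      move=> ltd; rewrite -ex /factor (nth_map 0) ?size_iota ?nth_iota //; lia.
    have ltj' : j < 2 * m by lia.
    rewrite -addnA !nthf; try lia.
    rewrite [RHS]nth_cat sx ifN ?addKn -?leqNgt ?leq_addr //.
    by rewrite catA nth_cat size_cat sx addnn -mul2n ltj'.
  have [|k [s [fs k1 les lee es]]] := run_complete m0 ax; first by lia.
  have [_ e1 _ e2 _] := run_start_third3 fs; have [r1 _ r2 _ _] := run_start_third3 fs.
  (* Runs of levels 1 and 2 are shorter than three periods. *)
  have k3 : 3 <= k.
    by case: k k1 les lee es => [|[|[|k]]] // *; lia.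
  exists k, s; split=> //; rewrite lee andbT.
  by have := third_period fs k3; lia.
have tp := third_period fs k3; have ab := @run_agree k s.
have ltab := run_start_lt k s.
set a := run_start k s in tp ab ltab *; set b := run_start k s.+1 in tp ab ltab *.
set m := b - a; have eb : b = a + m by rewrite /m; lia.
have m0 : 0 < m by rewrite /m; lia.
apply/cubesP; exists (n - 3 * m), m; split=> //; first by lia.
have per j : a <= j -> j + m < run_end k s -> f j = f (j + m).
  move=> aj lt; have := ab (j - a); rewrite subnKC //.
  have -> : b + (j - a) = j + m by lia.
  by apply.
exists (factor f (n - 3 * m) (n - 2 * m).-1).
  by rewrite size_map size_iota; lia.
apply: (@eq_from_nth _ false).
  by rewrite !size_cat !size_map !size_iota; lia.
move=> j; rewrite size_map size_iota => ltj.
rewrite /factor (nth_map 0) ?size_iota // nth_iota //.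
rewrite !nth_cat !size_map !size_iota.
have -> : (n - 2 * m).-1.+1 - (n - 3 * m) = m by lia.
case: ltnP => [lt1|ge1]; first by rewrite (nth_map 0) ?size_iota ?nth_iota.
case: ltnP => [lt2|ge2]; rewrite (nth_map 0) ?size_iota ?nth_iota; try lia.
  by rewrite [RHS]per; [congr f|..]; lia.
by rewrite [RHS]per; [rewrite [RHS]per; [congr f|..]|..]; lia.
Qed.

(** * States of positions and their substitution *)

(** Since [covered] includes [run_end k s], this is the first position past the interval of such a
    run, when its level is at least 3. *)
Definition ends (P : pred nat) (n : nat) : Prop :=
  exists k s, [/\ P k, f s = true & n = (run_end k s).+1].

Definition covered (b : bool) (n : nat) : Prop :=
  exists k s, [/\ 3 <= k, odd k = b, f s = true & third k s <= n <= run_end k s].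

(** Here level 3 originates: its interval is the single position [(phi n).+1]. *)
Definition at_end2 (n : nat) : Prop := exists2 s, f s = true & n = run_end 2 s.

Definition prev (n : nat) : option bool := if n is m.+1 then Some (f m) else None.

(* The letter at [n], the letter before it, and seven bits that tell which of the
   run ends and intervals of cubes [n] is at or in. By parity ([fib_run_end]), a
   run of even level ends before a letter 0 and one of odd level before a 1; this
   is why [phi] sends one class to the other. *)
Definition state : Type :=
  bool * option bool * bool * bool * bool * bool * bool * bool * bool.

Definition sat (n : nat) (q : state) : Prop :=
  let: (a, p, x0, x1, x2, y, z, A, B) := q in
  [/\ f n = a /\ prev n = p, (x0 <-> ends (pred1 0) n) /\ (x1 <-> ends (pred1 1) n),
      x2 <-> at_end2 n,
      (y <-> ends (fun k => ~~ odd k && (1 < k)) n) /\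
      (z <-> ends (fun k => odd k && (1 < k)) n)
    & (A <-> covered false n) /\ (B <-> covered true n)].

(** The entries are the states at [phi n] and, for a letter 0, at [(phi n).+1]. A letter 1 before
    [n] sets [x0], which passes to [x1] and then [x2], which opens a level 3 interval; [A] and [B]
    swap as levels change parity. *)
Definition gen (q : state) : seq state :=
  let: (a, p, x0, x1, x2, y, z, A, B) := q in
  (false, omap negb p, p == Some true, x0, x1, false, y, B || z, A)
  :: if a then [::]
     else [:: (true, Some false, p == Some false, false, false, x1 || z, false,
               B, A || x2)].

Lemma prev_phi n : prev (phi n) = omap negb (prev n).
Proof.
case: n => [//|n]; rewrite phiS [prev n.+1]/=; case fn: (f n).
  by rewrite addn1 /= fib_phi.
by rewrite addn2 /= fib_phiS.
Qed.

Lemma ends0_prev n : ends (pred1 0) n.+1 <-> prev n = Some true.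
Proof.
split=> [[k [s [/eqP-> fs]]] [->]|]; first by rewrite /= fs.
by case: n => //= n [fn]; exists 0, n.
Qed.

Lemma ends0_phi n : ends (pred1 0) (phi n) <-> prev n = Some true.
Proof.
case: n => [|n]; first by split=> // -[k [s []]].
rewrite phiS; case fn: (f n).
  rewrite addn1 ends0_prev prev_phi /= fn.
  case: n fn => [|n fn]; first by [].
  rewrite /=; case fm: (f n) => //; by rewrite fib_no11 in fn.
by rewrite addn2 ends0_prev /= fib_phi fn.
Qed.

Lemma ends0_phiS n : ends (pred1 0) (phi n).+1 <-> prev n = Some false.
Proof.
by rewrite ends0_prev prev_phi; case: (prev n) => [[]|].
Qed.

(** The letter at [run_end k s] is 0 here and 1 in the odd case. Its image has two letters or one,
    which decides whether the next end falls one before a block start or on it. *)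
Lemma run_endS_false k s : f s = true -> odd k = false ->
  (run_end k.+1 s).+1 = phi (run_end k s).+1.
Proof. by move=> fs ok; rewrite phiSf // fib_run_end. Qed.

Lemma run_endS_true k s : f s = true -> odd k = true ->
  run_end k.+1 s = phi (run_end k s).+1.
Proof. by move=> fs ok; rewrite phiSt // fib_run_end. Qed.

Lemma fib_run_end_succ k s : f s = true -> odd k = true -> f (run_end k s).+1 = false.
Proof. by move=> fs ok; rewrite fib_no11 // fib_run_end. Qed.

Lemma ends_odd_phi (P Q : pred nat) n :
  (forall k, P k -> odd k) -> (forall k, P k.+1 = Q k && ~~ odd k) ->
  ends P (phi n) <-> ends (fun k => Q k && ~~ odd k) n.
Proof.
move=> Podd PQ; split=> [[[|k] [s [Pk fs]]]|[k [s [Qk fs ->]]]].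
- by have := Podd _ Pk.
- have ok : odd k = false by have := Podd _ Pk; rewrite /= => /negbTE.
  by rewrite run_endS_false // => /phi_inj->; exists k, s; rewrite -PQ.
exists k.+1, s; rewrite PQ run_endS_false //.
by case/andP: Qk => _ /negbTE.
Qed.

Lemma ends_odd_phiS (P : pred nat) n : f n = false ->
  (forall k, P k -> odd k) -> ~ ends P (phi n).+1.
Proof.
move=> fn Podd [k [s [Pk fs e]]].
have := fib_phi_succ n; rewrite e fib_run_end_succ ?fn //; exact: Podd.
Qed.
Lemma ends_even_phi (P : pred nat) n :
  (forall k, P k -> ~~ odd k && (1 < k)) -> ~ ends P (phi n).
Proof.
move=> Pev [[|k] [s [Pk fs e]]]; have := Pev _ Pk; first by [].
case/andP=> /= /negPn ok _; have := fib_phi n.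
by rewrite e run_endS_true // fib_phi_succ fib_run_end_succ.
Qed.

Lemma ends_even_phiS n : f n = false ->
  ends (fun k => ~~ odd k && (1 < k)) (phi n).+1 <-> ends odd n.
Proof.
move=> fn; split=> [[[|k] [s [//= /andP[/negPn ok _] fs [e]]]]|].
  by exists k, s; move: e; rewrite run_endS_true // => /phi_inj.
move=> [k [s [ok fs ->]]]; exists k.+1, s; rewrite run_endS_true //=.
by rewrite ok; case: (k) ok.
Qed.

Lemma at_end2_phi n : at_end2 (phi n) <-> ends (pred1 1) n.
Proof.
split=> [[s fs]|[_ [s [/eqP-> fs ->]]]].
  by rewrite run_endS_true // => /phi_inj->; exists 1, s.
by exists s => //; rewrite (@run_endS_true 1).
Qed.

Lemma at_end2_phiS n : f n = false -> ~ at_end2 (phi n).+1.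
Proof.
by move=> fn [s fs e]; have := fib_phi_succ n; rewrite e fib_run_end // fn.
Qed.

(** The condition on [r] keeps [phi n + r] in the block of [n]. Even levels come from odd ones,
    whose interval image gains one position, the block start [phi (run_end k s).+1]. *)
Lemma covered_false_phi n r : r <= ~~ f n ->
  covered false (phi n + r) <->
  covered true n \/ (ends (fun k => odd k && (1 < k)) n /\ r = 0).
Proof.
move=> le_r; have ltn : phi n + r < phi n.+1.
  by rewrite phiS; case: (f n) le_r => /=; lia.
split=> [[[|k] [s [// k3 /= /negbFE ok fs]]]|].
  have {}k3 : 2 < k by case: k ok k3 => [|[|[|k]]].
  rewrite thirdS // run_endS_true // => /andP[le1 le2].
  have ge1 : third k s <= n by rewrite -ltnS -ltn_phi; lia.
  have le3 : n <= (run_end k s).+1 by rewrite -leq_phi; lia.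
  move: le3; rewrite leq_eqVlt => /predU1P[en|lt]; [right|left].
    split; last by subst n; lia.
    by exists k, s; split=> //; rewrite ok; lia.
  by exists k, s; split=> //; rewrite ge1.
case=> [[k [s [k3 ok fs /andP[le1 le2]]]]|[[k [s [/andP[ok k1] fs en]]] r0]].
  exists k.+1, s; rewrite /= ok thirdS // run_endS_true //; split=> //; first by lia.
  have : phi n.+1 <= phi (run_end k s).+1 by rewrite leq_phi.
  by have := leq_phi (third k s) n; rewrite le1; lia.
have k3 : 2 < k by case: (k) ok k1 => [|[|[|j]]].
exists k.+1, s; rewrite /= ok thirdS // run_endS_true //; split=> //.
rewrite r0 addn0 en leqnn andbT leq_phi.
by apply: leqW; apply: third_le.
Qed.

(** Intervals of even level map exactly onto whole blocks; the only other source is level 3, which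
    starts after an [at_end2] block start. *)
Lemma covered_true_phi n r : r <= ~~ f n ->
  covered true (phi n + r) <-> covered false n \/ (at_end2 n /\ r = 1).
Proof.
move=> le_r; have ltn : phi n + r < phi n.+1.
  by rewrite phiS; case: (f n) le_r => /=; lia.
split=> [[[|k] [s [// k3 /= /negbTE ok fs]]]|].
  move: k3; rewrite leq_eqVlt => /predU1P[[ek]|k3].
    subst k; rewrite -[third 3 s]/(run_end 3 s) -eqn_leq => /eqP; rewrite run_endS.
    have fE := fib_run_end 2 fs.
    case: r le_r {ltn} => [|[|r]]; last by case: (f n).
      by move=> _ e; case: (@phi_neqS n _ fE); lia.
    by rewrite addn1 => _ [/phi_inj]; right; split=> //; exists s.
  rewrite thirdS // => /andP[le1 le2]; left; exists k, s; split=> //.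
  have e2 := run_endS_false fs ok.
  have : phi n < phi (run_end k s).+1 by rewrite -e2; lia.
  have : phi (third k s) < phi n.+1 by lia.
  by rewrite !ltn_phi !ltnS => -> ->.
case=> [[k [s [k3 ok fs /andP[le1 le2]]]]|[[s fs ->] ->]]; last first.
  by exists 3, s; rewrite -[third 3 s]/(run_end 3 s) addn1 -run_endS; split; rewrite ?leqnn.
exists k.+1, s; rewrite /= ok thirdS //; split=> //; first by lia.
have e2 := run_endS_false fs ok.
have : phi n.+1 <= phi (run_end k s).+1 by rewrite leq_phi.
by have := leq_phi (third k s) n; rewrite le1; lia.
Qed.

Fixpoint sats (n : nat) (w : seq state) : Prop :=
  if w is q :: w' then sat n q /\ sats n.+1 w' else True.

Lemma sats_cat n w1 w2 : sats n (w1 ++ w2) <-> sats n w1 /\ sats (n + size w1) w2.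
Proof.
elim: w1 n => [|q w1 IH] n /=; first by rewrite addn0; tauto.
by rewrite IH addSnnS; tauto.
Qed.

Lemma size_gen n q : sat n q -> phi n.+1 = phi n + size (gen q).
Proof.
by case: q => [[[[[[[[a p] x0] x1] x2] y] z] A] B] [[fn _] _ _ _ _]; rewrite phiS fn; case: a {fn}.
Qed.

Lemma sat_gen n q : sat n q -> sats (phi n) (gen q).
Proof.
case: q => [[[[[[[[a p] x0] x1] x2] y] z] A] B] [[fn pn] [X0 X1] X2 [Y Z] [cA cB]].
have pE c : (p == Some c) <-> prev n = Some c by rewrite pn; split=> /eqP.
have odd1 k : pred1 1 k -> odd k by move/eqP->.
have oddz k : odd k && (1 < k) -> odd k by case/andP.
have cF := covered_false_phi; have cT := covered_true_phi.
split.
  have := cF n 0 (leq0n _); have := cT n 0 (leq0n _); rewrite addn0 => cT0 cF0.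
  split; rewrite ?fib_phi ?prev_phi ?pn //.
  - split; first by rewrite pE ends0_phi.
    rewrite X0 (@ends_odd_phi _ (pred1 0)) //; last by case=> [|[]].
    by split=> -[k [s [Pk fs ->]]]; exists k, s; split=> //; case: k Pk.
  - by rewrite X1 at_end2_phi.
  - split; first by split=> // /ends_even_phi; case.
    rewrite Y (@ends_odd_phi _ (fun k => 1 < k)) //; last first.
      by case=> [|[|k]] //=; rewrite andbT.
    by split=> -[k [s [Pk fs ->]]]; exists k, s; split=> //; rewrite andbC.
  split; first by rewrite cF0 -cB -Z; split=> [/orP[]|[->|[-> _]]]; rewrite ?orbT; auto.
  by rewrite cT0 cA; intuition.
case: a fn => fn //=; split=> //.
have le1 : 1 <= ~~ f n by rewrite fn.
have := cF n 1 le1; have := cT n 1 le1; rewrite addn1 => cT1 cF1.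
split; rewrite ?fib_phiS //= ?fib_phi //.
- split; first by rewrite pE ends0_phiS.
  by split=> // /ends_odd_phiS; case.
- by split=> // /at_end2_phiS; case.
- split; last by split=> // /ends_odd_phiS; case.
  rewrite ends_even_phiS //; split=> [/orP[/X1|/Z] [k [s [Pk fs ->]]]|].
  + by exists k, s; split=> //; exact: odd1.
  + by exists k, s; split=> //; exact: oddz.
  case=> [[|[|k]] [s [ok fs en]]] //; apply/orP; [left; apply/X1|right; apply/Z].
    by exists 1, s.
  by exists k.+2, s; rewrite ok.
split; first by rewrite cF1 cB; intuition.
rewrite cT1 -cA -X2; split=> [/orP[]|[->|[-> _]]] //; try tauto.
by rewrite orbT.
Qed.

Definition subst (w : seq state) : seq state := flatten (map gen w).

Lemma sats_subst n w : sats n w -> sats (phi n) (subst w).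
Proof.
elim: w n => [|q w IH] n //= [sq sw]; apply/sats_cat; split; first exact: sat_gen.
by rewrite -size_gen //; exact: IH.
Qed.

Definition state0 : state :=
  (false, None, false, false, false, false, false, false, false).

Lemma sat_state0 : sat 0 state0.
Proof.
split=> //; repeat split=> //; try by case=> k [s []].
all: case=> k [s [k3 _ fs /andP[le _]]].
all: by have := third_period fs k3; have := run_start_lt k s; lia.
Qed.

Definition mark (q : state) : bool :=
  let: (_, _, _, _, _, _, _, A, B) := q in A || B.

Lemma cubes_mark n q : sat n.+1 q -> cubes f n = mark q.
Proof.
case: q => [[[[[[[[a p] x0] x1] x2] y] z] A] B] [_ _ _ _ [cA cB]].
apply/idP/idP => /=.
  move/(cube_covered (ltn0Sn n)) => [k [s [k3 fs le]]]; apply/orP.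
  by case ok: (odd k); [right; apply/cB|left; apply/cA]; exists k, s.
move=> AB; apply/(cube_covered (ltn0Sn n)).
by case/orP: AB => [/cA|/cB] [k [s [k3 _ fs le]]]; exists k, s.
Qed.

(** * Possible lengths of runs of zeros *)

Definition marks (n l : nat) : seq bool := [seq cubes f k | k <- iota n l].

Lemma marksE n w : sats n.+1 w -> marks n (size w) = map mark w.
Proof.
by elim: w n => [|q w IH] n //= [/cubes_mark sq /IH<-]; rewrite /marks /= sq.
Qed.

Definition origin (k : nat) : seq state := iter k subst [:: state0].

Lemma sats_origin k : sats 0 (origin k).
Proof.
elim: k => [|k IH]; first by split=> //; exact: sat_state0.
by rewrite -phi0; exact: sats_subst.
Qed.

Lemma sats_drop n w i : sats n w -> sats (n + i) (drop i w).
Proof.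
elim: w n i => [|q w IH] n [|i] //=; rewrite ?addn0 //.
by move=> [_ sw]; rewrite -addSnnS; exact: IH.
Qed.

Lemma sats_take n w i : sats n w -> sats n (take i w).
Proof. by elim: w n i => [|q w IH] n [|i] //= [sq sw]; split=> //; exact: IH. Qed.

(** Only starts inside the image of the first letter are taken; later starts belong to the windows
    at later positions. *)
Definition children (l : nat) (w : seq state) : seq (seq state) :=
  [seq take l (drop r (subst w)) | r <- iota 0 (size (gen (head state0 w)))].

(** Ten is the length of a run of eight zeros with a 1 on each side. Without a second 1 the index is
    9 and the test fails. *)
Definition run_ok (w : seq state) : bool :=
  let m := map mark w in
  (size m == 10) && (nth false m 0 && ~~ nth false m 1 ==>
    (index true (behead m) \in [:: 1; 2; 3; 7; 8])).

Definition closed_windows (W : seq (seq state)) : bool :=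
  [&& [::] \notin W, take 10 (origin 6) \in W,
      all (fun w => all (mem W) (children 10 w)) W & all run_ok W].

Lemma closed_windows_exist : exists W, closed_windows W.
Proof.
(* Sixteen rounds reach the fixed point, a set of 194 windows. *)
exists (iter 16 (fun W => undup (W ++ flatten (map (children 10) W)))
         [:: take 10 (origin 6)]).
by vm_compute.
Qed.

(** Strong induction: a position [N > 0] lies in the block of some [n < N], and the window at [N] is
    a child of the one at [n]. *)
Lemma closed_windows_sats W N : closed_windows W -> exists2 w, w \in W & sats N w.
Proof.
case/and4P=> W_nil W0 /allP Wcl _; elim/ltn_ind: N => N IH.
case: (posnP N) => [->|N0].
  by exists (take 10 (origin 6)) => //; exact/sats_take/sats_origin.
have [n [r [lt ltn eN]]] : exists n r, [/\ n < N, r <= ~~ f n & N = phi n + r].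
  case: (phiP N) N0 => [n|n fn] n0; last first.
    by exists n, 1; rewrite fn addn1 ltnS phi_ge.
  exists n, 0; rewrite addn0; split=> //.
  case: n n0 => // n _; have := phi_ge_sub 1 n; rewrite add1n.
  by have -> : phi 1 = 2; [|lia].
have [w ww sw] := IH n lt.
exists (take 10 (drop r (subst w))); last first.
  by rewrite eN; apply/sats_take/sats_drop/sats_subst.
apply: (allP (Wcl _ ww)); apply: map_f.
case: w ww sw => [|q w ww [sq _]]; first by rewrite (negbTE W_nil).
rewrite mem_iota /=; have := size_gen sq.
by rewrite phiS; case: (f n) ltn => /=; lia.
Qed.

Lemma nth_marks n l k : k < l -> nth false (marks n l) k = cubes f (n + k).
Proof. by move=> lt; rewrite (nth_map 0) ?size_iota ?nth_iota. Qed.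

Lemma nth_zeros_one l k : nth false (rcons (nseq l false) true) k = (k == l).
Proof. by rewrite nth_rcons size_nseq nth_nseq; case: (ltngtP k l). Qed.

Lemma zero_run_inner i l : zero_run (cubes f) i.+1 l -> l \in [:: 1; 2; 3; 7; 8].
Proof.
case=> l1 zeros one [//|]; rewrite subn1 /= => ci.
have [W Wok] := closed_windows_exist.
(* A state at [n.+1] marks cubes ending at [n], so this window begins with the 1 preceding the
   run. *)
have [w + /marksE ew] := closed_windows_sats i.+1 Wok.
case/and4P: Wok => _ _ _ /allP Wok /Wok.
rewrite /run_ok -ew {1}/marks size_map size_iota.
case/andP=> /eqP sz; rewrite sz !nth_marks // addn0 addn1 ci.
have -> : cubes f i.+1 = false by rewrite -[i.+1]addn0 zeros.
rewrite [_ && _]/= implyTb -[behead _]/(marks i.+1 9).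
set j := index _ _ => jl; suff -> : l = j by [].
have j9 : j < 9 by move: jl; rewrite !inE; lia.
have cj : cubes f (i.+1 + j) = true.
  by rewrite -(nth_marks _ j9) nth_index // -index_mem size_map size_iota.
have [lj|jl'|//] := ltngtP l j; last by rewrite zeros in cj.
have := before_find false lj; rewrite nth_marks ?one //; lia.
Qed.

Lemma marks_start : marks 0 14 = rcons (nseq 13 false) true.
Proof.
(* States at positions 1 to 14 mark the cubes ending at 0 to 13. *)
have := marksE (sats_drop 1 (sats_take 15 (sats_origin 6))).
by have -> : size (drop 1 (take 15 (origin 6))) = 14; [|move->].
Qed.

Lemma zero_run_start l : zero_run (cubes f) 0 l <-> l = 13.
Proof.
have c k : k < 14 -> cubes f k = (k == 13).
  by move=> lt; rewrite -[k in LHS]add0n -(nth_marks 0 lt) marks_start nth_zeros_one.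
split=> [[_ zeros one _]|->]; last first.
  by split=> //; [move=> k lt; rewrite c; lia|rewrite c|left].
have [lt|gt|//] := ltngtP l 13.
  by rewrite c in one; lia.
by have := zeros 13 gt; rewrite c.
Qed.

Lemma zero_run_marks i l : 0 < l ->
  marks i l.+2 = true :: rcons (nseq l false) true -> zero_run (cubes f) i.+1 l.
Proof.
move=> l0 e; have c k : k < l.+1 -> cubes f (i.+1 + k) = (k == l).
  move=> lt; rewrite addSnnS -(@nth_marks _ l.+2) // e.
  exact: nth_zeros_one.
split=> //; [by move=> k lt; rewrite c; lia|by rewrite c ?eqxx|].
by right; rewrite subn1 /= -[i]addn0 -(@nth_marks _ l.+2) // e.
Qed.

(** * Recurrence of the runs *)

(** An occurrence at [k] yields one at [phi (phi k) + off > k]. The substitution is squared, which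
    preserves the parity of levels. *)
Lemma recurrent n off u : 0 < off -> sats n u ->
  take (size u) (drop off (subst (subst u))) = u ->
  forall N, exists2 k, N < k & sats k u.
Proof.
move=> off0 su eu; elim=> [|N [k ltk sk]].
  exists (phi (phi n) + off); first by lia.
  by rewrite -eu; apply/sats_take/sats_drop; do 2!apply: sats_subst.
exists (phi (phi k) + off); first by have := phi_ge k; have := phi_ge (phi k); lia.
by rewrite -eu; apply/sats_take/sats_drop; do 2!apply: sats_subst.
Qed.

Lemma recurrent_run l n off : 0 < l -> 0 < off ->
  let u := take l.+2 (drop n (origin 8)) in
  take (size u) (drop off (subst (subst u))) = u ->
  map mark u = true :: rcons (nseq l false) true ->
  forall N, exists2 i, N <= i & zero_run (cubes f) i l.
Proof.
move=> l0 off0 u eu mu N.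
have su : sats n u by rewrite -[n]add0n; exact/sats_take/sats_drop/sats_origin.
have [[//|k] ltk /marksE] := recurrent off0 su eu N; rewrite mu => mk.
exists k.+1; first exact: ltnW.
apply: zero_run_marks => //; rewrite -mk.
by have := congr1 size mu; rewrite size_map /= size_rcons size_nseq => ->.
Qed.

Theorem theorem2 :
  [/\ forall i l : nat, zero_run (cubes fib_word) i l ->
        l \in [:: 1; 2; 3; 7; 8; 13],
      forall i : nat, zero_run (cubes fib_word) i 13 <-> i = 0
    & forall l : nat, l \in [:: 1; 2; 3; 7; 8] ->
        forall N : nat, exists2 i, N <= i & zero_run (cubes fib_word) i l].
Proof.
split=> [[|i] l|[|i]|l].
- by move/zero_run_start->.
- by move/zero_run_inner; rewrite !inE; lia.
- by split=> // _; apply/zero_run_start.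
- by split=> // /zero_run_inner.
rewrite !inE => /or4P[/eqP->|/eqP->|/eqP->|/orP[]/eqP->].
(* The arguments are the run length, a position in [origin 8] of the run with its bordering ones,
   and the offset of that state word in its own twofold image. *)
- by apply: (@recurrent_run 1 35 3) => //; vm_compute.
- by apply: (@recurrent_run 2 24 3) => //; vm_compute.
- by apply: (@recurrent_run 3 40 3) => //; vm_compute.
- by apply: (@recurrent_run 7 27 11) => //; vm_compute.
- by apply: (@recurrent_run 8 14 11) => //; vm_compute.
Qed.
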